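(* Let $G$ be a simple graph of order $n$ with average degree $d$ and minimum degree $\delta\ge 1$, let $0=\sigma_0\le\sigma_1\le\cdots\le\sigma_{n-1}$ be its Laplacian eigenvalues, and let $\theta\ge0$ be a real number such that $|d-\sigma_i|\le\theta$ for all $i=1,\dots,n-1$. If $$\delta-(2+2\sqrt{3})^2\frac{\theta^2}{\delta}\ge\frac{2n\theta+d}{d+\theta},$$ then $G$ is Hamiltonian.
   Context: The Laplacian matrix of $G$ is $L(G)=D(G)-A(G)$ (degree diagonal matrix minus adjacency matrix); its eigenvalues are the Laplacian eigenvalues, ordered increasingly. The average degree is $d=\frac1n\sum_v d_v$. $G$ is Hamiltonian if it contains a cycle passing through every vertex exactly once. *)

(* Defs.v *)
From HB Require Import structures.
From mathcomp Require Import all_boot all_order all_algebra.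
From mathcomp Require Import reals.

Set Implicit Arguments.
Unset Strict Implicit.
Unset Printing Implicit Defensive.

Import Order.TTheory GRing.Theory Num.Theory.

Local Open Scope ring_scope.

(* A simple graph on the finite vertex type V is a symmetric irreflexive
   relation e : rel V. *)

Definition degree (V : finType) (e : rel V) (v : V) : nat :=
  #|[set w | e v w]|.

(* In an irreflexive graph every degree is less than #|V|, so the default value
   #|V| of the minimum only matters on the empty vertex type, where the result
   is 0. *)
Definition min_degree (V : finType) (e : rel V) : nat :=
  \big[minn/#|V|]_(v : V) degree e v.

Definition avg_degree (R : realType) (V : finType) (e : rel V) : R :=
  (\sum_(v : V) (degree e v)%:R) / #|V|%:R.

(* Rows and columns are indexed by the vertices through enum_val. *)
Definition adjacency_mx (R : realType) (V : finType) (e : rel V) : 'M[R]_#|V| :=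
  \matrix_(i, j) (e (enum_val i) (enum_val j))%:R.

Definition degree_mx (R : realType) (V : finType) (e : rel V) : 'M[R]_#|V| :=
  diag_mx (\row_i (degree e (enum_val i))%:R).

Definition laplacian_mx (R : realType) (V : finType) (e : rel V) : 'M[R]_#|V| :=
  degree_mx R e - adjacency_mx R e.

(* s lists the eigenvalues of A in nondecreasing order, each repeated according
   to its (algebraic, hence for symmetric A also geometric) multiplicity. *)
Definition ordered_eigenvalues (R : realType) (n : nat) (A : 'M[R]_n)
    (s : n.-tuple R) : Prop :=
  sorted <=%R s /\ char_poly A = \prod_(x <- s) ('X - x%:P).

(* ucycle also accepts the empty sequence and, on an edge xy, the closed walk
   [:: x; y]; neither is a cycle of a simple graph, hence the size bound. *)
Definition hamiltonian (V : finType) (e : rel V) : Prop :=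
  exists c : seq V, [/\ (2 < size c)%N, ucycle e c & forall v : V, v \in c].

(* Main.v *)
(** The Chvatal-Erdos condition (every independent set is at most as large as
every vertex separator) forces a Hamiltonian cycle.  Indeed, if [c] is a longest
cycle missing a vertex [v], let [A] be the component of [v] off [c] and [S] the
neighbours of [A] on [c]: the successors of [S] along [c], together with [v],
form an independent set of size [#|S| + 1], while [S] separates [A] from those
successors.

The eigenvalue hypothesis says that [L - d] has norm at most [theta] on the
orthogonal complement of the constants, which gives an expander mixing lemma for
the Laplacian quadratic form of two indicator vectors.  Mixing a set with itself
bounds independent sets by [(2 n theta + d - theta) / (d + theta)].  If a
separator [S] were smaller than some independent set, the smaller separated part
[A] would satisfy [#|A| <= n theta / (d + theta)], so mixing would force many
edges from [A] to its complement; they all go to [S], and mixing [A] with [S]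
allows fewer because [#|S| < #|A| delta^2 / (25 theta^2)].  The constant 25,
smaller than [(2 + 2 sqrt 3)^2], is enough here since the hypothesis also
bounds [S] by [2 n theta / (d + theta)]. *)

Require Import Defs.
From HB Require Import structures.
From mathcomp Require Import all_boot all_order all_fingroup all_algebra.
From mathcomp Require Import reals complex.
From mathcomp Require Import ring lra.

Set Implicit Arguments.
Unset Strict Implicit.
Unset Printing Implicit Defensive.

Import Order.TTheory GRing.Theory Num.Theory.

(** * Rerouting a longest cycle through vertices off it *)

Section LongestCycle.
Variables (V : finType) (e : rel V).
Hypothesis e_sym : symmetric e.
Variable c : seq V.
Hypotheses (c_cycle : ucycle e c)
  (c_max : forall c', ucycle e c' -> (size c' <= size c)%N).

Lemma rev_path_sym (x : V) (p : seq V) :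
  path e (last x p) (rev (belast x p)) = path e x p.
Proof. by rewrite rev_path; apply: eq_path => y z; rewrite e_sym. Qed.

(** Otherwise [q] could be inserted between [x] and its successor, giving a longer cycle. *)
Lemma longest_cycle_no_detour (x : V) (q : seq V) :
  x \in c -> uniq q -> q != [::] -> ~~ has (mem c) q -> path e x q ->
  ~~ e (last x q) (next c x).
Proof.
move=> xc q_uniq q_ne q_c xq; apply/negP => qy.
have /andP[c_e c_u] := c_cycle.
have yc : next c x \in c by rewrite mem_next.
(* Rotated to start at the successor of [x], the cycle ends at [x], so the detour is simply
   appended. *)
have [i t ct] := rot_to yc.
have := cycle_next c_u; rewrite -(rot_cycle i) ct /= rcons_path => /andP[_ /eqP].
have := can_inj (prev_next c_u) => /[apply] tx.
have : ucycle e (next c x :: t ++ q).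
  rewrite /ucycle /= rcons_cat cat_path tx rcons_path xq qy /= andbT.
  move: c_e; rewrite -(rot_cycle i) ct /= rcons_path => /andP[-> _] /=.
  move: c_u; rewrite -(rot_uniq i) ct /= cat_uniq mem_cat negb_or => /andP[-> ->].
  rewrite q_uniq !andbT /=; apply/andP; split.
    by apply: contra q_c => yq; apply/hasP; exists (next c x).
  apply: contra q_c => /hasP[z zq zt]; apply/hasP; exists z => //=.
  by rewrite -(mem_rot i) ct inE (zt : z \in t) orbT.
move/c_max; rewrite /= size_cat -(size_rot i c) ct /= -[X in (_ <= X)%N]addn0.
by rewrite -addSn leq_add2l leqn0 size_eq0 (negPf q_ne).
Qed.

(** If the successors [y1], [y2] were adjacent, a longer cycle would run forward from [y1] to [x2],
    through [q] to [x1], backward to [y2], and close up with the edge from [y2] to [y1]. *)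
Lemma longest_cycle_next_indep (x1 x2 : V) (q : seq V) :
  x1 \in c -> x2 \in c -> x1 != x2 ->
  uniq q -> q != [::] -> ~~ has (mem c) q -> path e x2 q -> e (last x2 q) x1 ->
  ~~ e (next c x1) (next c x2).
Proof.
move=> x1c x2c x12 q_uniq q_ne q_c xq qx1; apply/negP => y12.
have /andP[c_e c_u] := c_cycle.
have yc : next c x1 \in c by rewrite mem_next.
have [i t ct] := rot_to yc.
have nextI := can_inj (prev_next c_u).
have := cycle_next c_u; rewrite -(rot_cycle i) ct /= => c_next.
have x2t : x2 \in next c x1 :: t by rewrite -ct mem_rot.
have := c_next; rewrite rcons_path => /andP[_ /eqP/nextI tx1].
(* An empty second arc would make [x2] the last vertex of the rotated cycle, which is [x1]. *)
case/splitPl: x2t ct c_next tx1 => t1 [|y2 t2] t1x2 ct.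
  by move=> _; rewrite cats0 t1x2 => x21; rewrite x21 eqxx in x12.
rewrite rcons_cat cat_path t1x2 /= last_cat /= => /and3P[_ /eqP y2E _] t2x1.
rewrite y2E in y12.
have : ucycle e (next c x1 :: t1 ++ q ++ rev (y2 :: t2)).
  move: c_e; rewrite -(rot_cycle i) ct /= rcons_path cat_path /= => /andP[].
  move=> /and3P[t1p _ t2p] _.
  move: c_u; rewrite -(rot_uniq i) ct /=.
  rewrite mem_cat cat_uniq => /and4P[y1t t1u t12u t2u].
  have qcE z : z \in q -> z \notin c.
    by move=> zq; apply: contra q_c => zc; apply/hasP; exists z.
  have cE z : (z \in c) = (z \in next c x1 :: t1 ++ y2 :: t2) by rewrite -ct mem_rot.
  have rP : path e x1 (rcons (rev (belast y2 t2)) (next c x1)).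
    by rewrite -rev_cons -{1}t2x1 -[last y2 t2]/(last (next c x1) (y2 :: t2))
               (rev_path_sym _ (y2 :: t2)) /= y12.
  apply/andP; split.
    rewrite /= rcons_path cat_path t1p t1x2 cat_path xq /=.
    by move: rP; rewrite lastI rev_rcons rcons_path !last_cat /= t2x1 qx1.
  rewrite /= !cat_uniq !mem_cat mem_rev rev_uniq t1u q_uniq t2u /= !andbT.
  apply/and3P; split.
  - move: y1t; rewrite !negb_or => /andP[-> ->]; rewrite andbT /=.
    by apply: contraL yc => /qcE.
  - rewrite has_cat has_rev negb_or t12u andbT.
    by apply/hasPn => z /qcE; rewrite cE inE mem_cat !negb_or => /and3P[].
  - rewrite has_rev; apply/hasPn => z zt; apply/negP => /qcE.
    by rewrite cE inE mem_cat zt !orbT.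
move/c_max; rewrite /= !size_cat size_rev -(size_rot i c) ct /= size_cat /=.
by rewrite addnCA -[X in (_ <= X)%N]add0n -addnS leq_add2r leqn0 size_eq0 (negPf q_ne).
Qed.
End LongestCycle.

(** * The Chvatal-Erdos condition *)

Section ChvatalErdos.
Variables (V : finType) (e : rel V).
Hypotheses (e_sym : symmetric e) (e_irr : irreflexive e).

Lemma uniq_path_off (c : seq V) (h1 h2 : V) :
  let e' := [rel x y | [&& e x y, x \notin c & y \notin c]] in
  h1 \notin c -> connect e' h1 h2 ->
  exists q, [/\ uniq (h1 :: q), ~~ has (mem c) (h1 :: q), path e h1 q
              & last h1 q = h2].
Proof.
move=> e' h1c /connectP[p /shortenP[q q_path q_uniq _] ->]; exists q; split=> //.
  rewrite /= negb_or h1c /=; elim: q h1 {h1c q_uniq} q_path => //= y q IH x.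
  by case/andP=> /and3P[_ _ yc] /IH qc; rewrite negb_or yc.
by apply: sub_path q_path => x y /and3P[].
Qed.

Lemma longest_cycle_separator (c : seq V) (v : V) :
  c != [::] -> ucycle e c -> (forall c', ucycle e c' -> (size c' <= size c)%N) ->
  v \notin c ->
  exists A B I : {set V},
    [/\ A != set0, B != set0, [disjoint A & B],
        {in A & B, forall x y, ~~ e x y}
      & {in I &, forall x y, ~~ e x y} /\ (#|~: (A :|: B)| < #|I|)%N].
Proof.
move=> c_ne c_cycle c_max vc; have /andP[_ c_uniq] := c_cycle.
pose e' := [rel x y | [&& e x y, x \notin c & y \notin c]].
have e'_sym : connect_sym e'.
  by apply: sym_connect_sym => x y; rewrite /= e_sym [(x \notin c) && _]andbC.
pose H := [set w | connect e' v w].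
pose S := [set x in c | [exists h in H, e x h]].
pose N := [set next c x | x in S].
have Hc h : h \in H -> h \notin c.
  rewrite inE => /(uniq_path_off vc)[q [_ /hasPn qc _ <-]].
  by apply: qc; apply: mem_last.
(* Any two vertices of [S], equal or not, are joined through [H], because [H] is connected off the
   cycle. *)
have detour x y : x \in S -> y \in S -> exists q,
    [/\ uniq q, q != [::], ~~ has (mem c) q, path e x q & e (last x q) y].
  rewrite !inE => /andP[xc /exists_inP[h hH xh]] /andP[yc /exists_inP[k kH yk]].
  have hk : connect e' h k.
    by move: hH kH; rewrite !inE e'_sym; apply: connect_trans.
  have [q [qu qc qp ql]] := uniq_path_off (Hc _ hH) hk.
  by exists (h :: q); rewrite /= xh ql e_sym.
have Sc x : x \in S -> x \in c by rewrite inE => /andP[].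
have SN x : x \in S -> next c x \notin S.
  move=> xS; apply/negP => yS; have [q [qu q0 qc qp ql]] := detour _ _ xS yS.
  by have := longest_cycle_no_detour c_cycle c_max (Sc _ xS) qu q0 qc qp; rewrite ql.
have NN : {in N &, forall x y, ~~ e x y}.
  move=> _ _ /imsetP[x xS ->] /imsetP[y yS ->].
  have [->|xy] := eqVneq x y; first by rewrite e_irr.
  have [q [qu q0 qc qp ql]] := detour _ _ yS xS.
  exact: (longest_cycle_next_indep e_sym c_cycle c_max
            (Sc _ xS) (Sc _ yS) xy qu q0 qc qp ql).
have Nc y : y \in N -> y \in c by case/imsetP=> x /Sc xc ->; rewrite mem_next.
have vH : v \in H by rewrite inE connect0.
(* A vertex of [N] adjacent to [v] would lie in [S], which [SN] forbids. *)
have vN y : y \in N -> ~~ e v y.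
  move=> yN; apply/negP => vy; case/imsetP: (yN) => x xS yE.
  have /negP[] := SN _ xS; rewrite -yE inE Nc //=.
  by apply/exists_inP; exists v => //; rewrite e_sym.
have HSE : ~: (H :|: ~: (H :|: S)) = S.
  apply/setP=> x; rewrite !in_setC !in_setU in_setC in_setU negb_or negbK.
  by case xH: (x \in H) => //=; apply/esym/negP => /Sc; apply/negP/Hc.
exists H, (~: (H :|: S)), (v |: N); split.
- by apply/set0Pn; exists v.
(* The second part contains a cycle vertex: any [x] outside [S], or else the successor of an [x] in
   [S]. *)
- have [x xc] : exists x, x \in c.
    by case: (c) c_ne => // x p _; exists x; rewrite mem_head.
  have cH z : z \in c -> z \notin H by apply: contraL; apply: Hc.
  apply/set0Pn; case: (boolP (x \in S)) => xS; last first.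
    by exists x; rewrite in_setC in_setU negb_or xS cH.
  by exists (next c x); rewrite in_setC in_setU negb_or SN ?cH ?mem_next.
- by rewrite disjoints_subset setCK subsetUl.
- move=> x y xH; rewrite !inE negb_or => /andP[yH yS]; apply/negP => xy.
  have yc : y \notin c.
    apply: contra yS => yc; rewrite yc; apply/exists_inP; exists x => //.
    by rewrite e_sym.
  have vx : connect e' v x by move: xH; rewrite inE.
  case/negP: yH; apply: connect_trans vx _.
  by apply: connect1; rewrite /= xy yc Hc.
- split.
    move=> x y /setU1P[->|xN] /setU1P[->|yN]; first by rewrite e_irr.
    + exact: vN.
    + by rewrite e_sym vN.
    + exact: NN.
  rewrite HSE cardsU1 card_imset; last exact: can_inj (prev_next c_uniq).
  by case: (boolP (v \in N)) => // /Nc; rewrite (negPf vc).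
Qed.

Theorem chvatal_erdos :
  (2 < #|V|)%N -> (exists x y, e x y) ->
  (forall A B I : {set V}, A != set0 -> B != set0 -> [disjoint A & B] ->
     {in A & B, forall x y, ~~ e x y} -> {in I &, forall x y, ~~ e x y} ->
     (#|I| <= #|~: (A :|: B)|)%N) ->
  hamiltonian e.
Proof.
move=> V_gt2 [x [y xy]] sep.
pose P k := [exists t : k.-tuple V, ucycleb e t].
(* The closed walk along a single edge is a [ucycle], so a longest one exists before any genuine
   cycle is known; its length exceeds 2 only once it is shown to span [V]. *)
have Pex : exists k, P k.
  exists 2; apply/existsP; exists [tuple x; y].
  rewrite /ucycleb /= inE xy e_sym xy /=.
  by rewrite andbT; apply/eqP => xyE; rewrite xyE e_irr in xy.
have Pmax k : P k -> (k <= #|V|)%N.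
  by case/existsP=> t /andP[_ /card_uniqP]; rewrite size_tuple => <-; apply: max_card.
case: (ex_maxnP Pex Pmax) => k /existsP[t t_cycle] k_max.
have c_max c : ucycle e c -> (size c <= size t)%N.
  move=> c_cycle; rewrite size_tuple; apply: k_max.
  by apply/existsP; exists (in_tuple c).
have t_ne : t != [::] :> seq V.
  have /c_max : ucycle e [:: x; y].
    rewrite /ucycle /= inE xy e_sym xy /= andbT.
    by apply/eqP => xyE; rewrite xyE e_irr in xy.
  by case: (tval t).
have t_all v : v \in t.
  apply/negPn/negP => vt.
  have [A [B [I [A0 B0 AB eAB [I_indep]]]]] :=
    longest_cycle_separator t_ne t_cycle c_max vt.
  by rewrite ltnNge (sep A B I).
exists t; split=> //; have /andP[_ /card_uniqP tV] := t_cycle.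
by rewrite -tV (eq_card (B := V)).
Qed.

End ChvatalErdos.

Local Open Scope ring_scope.

(** * Spectral theorem for real symmetric matrices *)

Section Spectral.
Local Open Scope sesquilinear_scope.

Lemma char_poly_conj (F : fieldType) (n : nat) (P A B : 'M[F]_n) :
  P \in unitmx -> P *m A = B *m P -> char_poly A = char_poly B.
Proof.
move=> Pu PAB; pose Q := map_mx polyC P.
have Qdet : \det Q != 0 by rewrite det_map_mx polyC_eq0 -unitfE -unitmxE.
(* Multiplying by the nonzero [\det Q] avoids inverting [Q] over the polynomials. *)
apply: (mulfI Qdet); rewrite [RHS]mulrC -!det_mulmx; congr (\det _).
rewrite /char_poly_mx mulmxBr mulmxBl -!map_mxM PAB; congr (_ - _).
by rewrite scalar_mxC.
Qed.

Section SymmetricSpectrum.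
Variable R : rcfType.
Local Notation C := R[i].
Local Notation toC := (map_mx (real_complex R)).

Lemma conj_real_complex (x : R) : (x%:C)%C ^* = (x%:C)%C.
Proof. by apply: CrealP; apply/complex_realP; exists x. Qed.

Lemma trC_real_mx (m n : nat) (A : 'M[R]_(m, n)) : (toC A)^t* = toC A^T.
Proof. by apply/matrixP => i j; rewrite !mxE conj_real_complex. Qed.

(** The complex spectral theorem diagonalizes [A] with eigenvalues in some order; comparing the
    linear factors of the characteristic polynomial yields a permutation matching them to [s], and
    the rows are permuted accordingly. *)
Lemma symmetric_eigenbasis (n : nat) (A : 'M[R]_n) (s : n.-tuple R) :
  A^T = A -> char_poly A = \prod_(x <- s) ('X - x%:P) ->
  exists2 U : 'M[C]_n, U \is unitarymx &
    U *m toC A = diag_mx (\row_i (tnth s i)%:C%C) *m U.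
Proof.
move=> A_sym A_char; pose B := toC A; pose P := spectralmx B.
have Pu : P \is unitarymx := spectral_unitarymx B.
have /orthomx_spectralP : B \is normalmx.
  by apply/normalmxP; rewrite trC_real_mx A_sym.
rewrite -/P; set d := spectral_diag B => BE.
have PB : P *m B = diag_mx d *m P.
  by rewrite {1}BE !mulmxA mulmxV ?mul1mx // spectral_unit.
pose t := [tuple (tnth s i)%:C%C | i < n].
have /tuple_permP[p dE] : perm_eq [tuple d 0 i | i < n] t.
  apply: prod_XsubC_eq.
  transitivity (char_poly B).
    rewrite (char_poly_conj (spectral_unit B) PB) char_poly_trig ?diag_mx_is_trig //.
    by rewrite big_tuple; apply: eq_bigr => i _; rewrite tnth_mktuple !mxE eqxx.
  rewrite -map_char_poly A_char rmorph_prod !big_tuple.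
  by apply: eq_bigr => i _; rewrite /= map_polyXsubC tnth_mktuple.
have dp i : d 0 (p^-1%g i) = (tnth s i)%:C%C.
  have /val_inj/(congr1 (fun t : n.-tuple C => tnth t (p^-1%g i))) := dE.
  by rewrite !tnth_mktuple permKV.
exists (row_perm p^-1 P).
  apply/unitarymxP/matrixP => i j.
  have /unitarymxP/matrixP/(_ (p^-1%g i) (p^-1%g j)) := Pu.
  rewrite !mxE (inj_eq perm_inj) => <-.
  by apply: eq_bigr => k _; rewrite !mxE.
apply/matrixP => i j; have /matrixP/(_ (p^-1%g i) j) := PB.
rewrite !mul_diag_mx !mxE dp => <-.
by apply: eq_bigr => k _; rewrite !mxE.
Qed.

(** In an eigenbasis [A - c] scales coordinate [i] by [tnth s i - c], at most [r] in absolute value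
    unless [i] is 0. Since the other eigenvalues are nonzero, the kernel vector [u] spans the
    eigenline of index 0, so [x] has no component there; Parseval concludes. *)
Lemma symmetric_deviation_bound (n : nat) (A : 'M[R]_n) (s : n.-tuple R)
    (c r : R) (u x y : 'rV[R]_n) :
  A^T = A -> char_poly A = \prod_(z <- s) ('X - z%:P) ->
  (forall i : 'I_n, (0 < i)%N -> tnth s i != 0 /\ `|c - tnth s i| <= r) ->
  u != 0 -> u *m A = 0 -> x *m u^T = 0 -> y = x *m A - c *: x ->
  (y *m y^T) 0 0 <= r ^+ 2 * (x *m x^T) 0 0.
Proof.
move=> A_sym A_char s_bound u0 uA xu yE.
have [U Uu UA] := symmetric_eigenbasis A_sym A_char.
have UUt : U *m U^t* = 1%:M by apply/unitarymxP.
have UtU : U^t* *m U = 1%:M by apply: mulmx1C.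
have parseval (v w : 'rV[R]_n) :
    ((v *m w^T) 0 0)%:C%C
    = \sum_i (toC v *m U^t*) 0 i * ((toC w *m U^t*) 0 i)^*.
  transitivity ((toC v *m U^t* *m (toC w *m U^t*)^t*) 0 0).
    rewrite trmx_mul map_mxM trmxCK mulmxA -(mulmxA _ _ U) UtU mulmx1.
    by rewrite trC_real_mx -map_mxM [RHS]mxE.
  by rewrite mxE; apply: eq_bigr => i _; rewrite !mxE.
have coordA (v : 'rV[R]_n) i :
    (toC (v *m A) *m U^t*) 0 i = (toC v *m U^t*) 0 i * (tnth s i)%:C%C.
  have AUt : toC A *m U^t* = U^t* *m diag_mx (\row_i (tnth s i)%:C%C).
    by rewrite -[LHS]mul1mx -UtU mulmxA -(mulmxA _ U) UA -mulmxA -mulmxA UUt mulmx1.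
  by rewrite map_mxM -mulmxA AUt mulmxA mul_mx_diag !mxE.
have u_coord (i : 'I_n) : (0 < i)%N -> (toC u *m U^t*) 0 i = 0.
  case/s_bound=> si0 _; have := coordA u i.
  rewrite uA map_mx0 mul0mx mxE => /esym/eqP; rewrite mulf_eq0 => /orP[/eqP//|].
  by rewrite (inj_eq (@complexI R) _ 0) (negPf si0).
(* Only the coordinate of [u] at index 0 is nonzero, so [x] orthogonal to [u] kills it. *)
have x_coord (i : 'I_n) : i = 0%N :> nat -> (toC x *m U^t*) 0 i = 0.
  move=> i0; have := parseval x u; rewrite xu mxE (bigD1 i) //= big1 ?addr0.
    move=> /esym/eqP; rewrite mulf_eq0 conjC_eq0 => /orP[/eqP//|/eqP ui0].
    case/negP: u0; rewrite -(map_mx_eq0 (real_complex R)) -[toC u]mulmx1 -UtU mulmxA.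
    apply/eqP; rewrite [_ *m U^t*](_ : _ = 0) ?mul0mx //.
    apply/matrixP => k j; rewrite ord1 [RHS]mxE.
    have [/u_coord //|] := ltnP 0 j; rewrite leqn0 => /eqP j0.
    by rewrite (_ : j = i) //; apply/val_inj; rewrite /= j0 i0.
  move=> j ji; rewrite [X in _ * X^*]u_coord ?rmorph0 ?mulr0 // lt0n.
  by apply: contra ji => /eqP j0; apply/eqP/val_inj; rewrite /= j0 i0.
rewrite -lecR rmorphM /= !parseval mulr_sumr; apply: ler_sum => i _.
have -> : (toC y *m U^t*) 0 i = (toC x *m U^t*) 0 i * (tnth s i - c)%:C%C.
  by rewrite yE map_mxB map_mxZ mulmxBl -scalemxAl mxE coordA !mxE rmorphB mulrBr
             [_ * (c%:C)%C]mulrC.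
rewrite -!normCK normrM exprMn mulrC.
have [i0|] := posnP i; first by rewrite x_coord // normr0 expr0n /= !mulr0.
case/s_bound=> _ si; rewrite ler_wpM2r ?exprn_ge0 //.
rewrite normc_def -!rmorphXn lecR /= expr0n addr0 sqrtr_sqr distrC.
by rewrite ler_pXn2r ?nnegrE ?normr_ge0 ?(le_trans (normr_ge0 _) si).
Qed.

End SymmetricSpectrum.

End Spectral.

Local Notation "''[' u , v ]" := ((u *m v^T) 0 0) : ring_scope.

(** * Dot product of row vectors and Cauchy-Schwarz *)

Section RowDot.
Variables (F : comNzRingType) (n : nat).
Implicit Types (u v w : 'rV[F]_n) (a b : F).

Lemma row_dotC u v : '[u, v] = '[v, u].
Proof. by rewrite -[u *m _]trmxK trmx_mul trmxK mxE. Qed.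

Lemma row_dotBl a b u v w : '[a *: u - b *: v, w] = a * '[u, w] - b * '[v, w].
Proof. by rewrite mulmxBl -!scalemxAl !mxE. Qed.

Lemma row_dotBr a b u v w : '[w, a *: u - b *: v] = a * '[w, u] - b * '[w, v].
Proof. by rewrite ![ '[w, _]]row_dotC row_dotBl. Qed.

End RowDot.

Lemma row_cauchy_schwarz (R : realFieldType) (n : nat) (y z : 'rV[R]_n) :
  '[y, z] ^+ 2 <= '[y, y] * '[z, z].
Proof.
have sqE (u : 'rV[R]_n) : '[u, u] = \sum_i u 0 i ^+ 2.
  by rewrite mxE; apply: eq_bigr => i _; rewrite mxE expr2.
have sq_ge0 (u : 'rV[R]_n) : 0 <= '[u, u].
  by rewrite sqE sumr_ge0 // => i _; apply: sqr_ge0.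
set Y := '[y, y]; set P := '[y, z]; set Z := '[z, z].
(* This is the squared norm of [Z *: y - P *: z]; the case [Z = 0], where [z] vanishes, is treated
   apart. *)
have : 0 <= Z * (Z * Y - P ^+ 2).
  have := sq_ge0 (Z *: y - P *: z).
  rewrite row_dotBl !row_dotBr (row_dotC z y) -/Y -/P -/Z.
  by congr (0 <= _); ring.
have [Z0|Zneq0] := eqVneq Z 0; last first.
  by rewrite pmulr_rge0 ?lt_def ?Zneq0 ?sq_ge0 // subr_ge0 mulrC.
move=> _; rewrite Z0 mulr0 [P](_ : _ = 0) ?expr0n //.
rewrite /P mxE big1 // => i _; rewrite mxE.
move/eqP: Z0; rewrite /Z sqE psumr_eq0 => [/allP/(_ i)|j _]; last exact: sqr_ge0.
by rewrite mem_index_enum /= sqrf_eq0 => /(_ isT)/eqP->; rewrite mulr0.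
Qed.

(** * Expander mixing for the Laplacian *)

Section Laplacian.
Variables (R : realType) (V : finType) (e : rel V).
Hypothesis e_sym : symmetric e.
Local Notation L := (laplacian_mx R e).
Local Notation n := (#|V|%:R : R).
Local Notation d := (avg_degree R e).

(** Ordered pairs are counted, so an edge inside [A :&: B] counts twice, as in the bilinear form of
    the adjacency matrix. *)
Definition edges (A B : {set V}) : nat := \sum_(x in A) #|[set y in B | e x y]|.

Definition ind_row (A : {set V}) : 'rV[R]_#|V| := \row_i (enum_val i \in A)%:R.

Lemma min_degree_le (v : V) : (min_degree e <= degree e v)%N.
Proof.
rewrite /min_degree; elim: (index_enum V) (mem_index_enum v) => // w s IHs.
rewrite inE big_cons geq_min => /orP[/eqP<-|/IHs->]; last by rewrite orbT.
by rewrite leqnn.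
Qed.

Lemma sum_enum_val (F : V -> R) : \sum_(i < #|V|) F (enum_val i) = \sum_v F v.
Proof. by rewrite -(big_enum_val (A := V)). Qed.

Lemma laplacian_sym : L^T = L.
Proof.
by apply/matrixP => i j; rewrite !mxE e_sym eq_sym; case: eqVneq => [->|].
Qed.

Lemma ind_rowM (A B : {set V}) : '[ind_row A, ind_row B] = #|A :&: B|%:R.
Proof.
rewrite mxE; under [LHS]eq_bigr do rewrite !mxE.
rewrite (sum_enum_val (fun v => (v \in A)%:R * (v \in B)%:R)).
rewrite -sum1_card natr_sum [RHS]big_mkcond; apply: eq_bigr => v _.
by rewrite inE; case: (v \in A); case: (v \in B); rewrite ?mulr1 ?mulr0.
Qed.

Lemma laplacianE i j :
  L i j = (degree e (enum_val i))%:R *+ (enum_val i == enum_val j)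
          - (e (enum_val i) (enum_val j))%:R.
Proof. by rewrite !mxE (inj_eq enum_val_inj). Qed.

Lemma ind_row_laplacian (A : {set V}) :
  ind_row A *m L
  = \row_j ((degree e (enum_val j))%:R *+ (enum_val j \in A)
             - #|[set x in A | e (enum_val j) x]|%:R).
Proof.
apply/rowP => j; rewrite [RHS]mxE; set w := enum_val j.
rewrite mxE; under eq_bigr do rewrite mxE laplacianE -/w.
rewrite (sum_enum_val (fun v =>
  (v \in A)%:R * ((degree e v)%:R *+ (v == w) - (e v w)%:R))).
under eq_bigr do rewrite mulrBr; rewrite big_split /= sumrN; congr (_ - _).
  rewrite (bigD1 w) //= big1 ?addr0 => [|v /negPf->]; last by rewrite mulr0.
  by rewrite eqxx mulr_natl mulr1n.
rewrite -sum1_card natr_sum [RHS]big_mkcond; apply: eq_bigr => v _.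
by rewrite inE (e_sym v); case: (v \in A); case: (e w v); rewrite ?mulr1 ?mulr0.
Qed.

Lemma ind_row_laplacian_dot (A B : {set V}) :
  '[ind_row A *m L, ind_row B]
  = (\sum_(v in A :&: B) degree e v)%:R - (edges A B)%:R.
Proof.
rewrite row_dotC trmx_mul laplacian_sym mulmxA.
rewrite ind_row_laplacian mxE; under [LHS]eq_bigr do rewrite !mxE.
rewrite (sum_enum_val (fun v => ((degree e v)%:R *+ (v \in B)
  - #|[set x in B | e v x]|%:R) * (v \in A)%:R)).
under [LHS]eq_bigr do rewrite mulrBl; rewrite big_split /= sumrN; congr (_ - _).
  rewrite natr_sum [RHS]big_mkcond; apply: eq_bigr => v _.
  by rewrite inE; case: (v \in A); case: (v \in B); rewrite ?mulr1 ?mulr0.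
rewrite natr_sum [RHS]big_mkcond; apply: eq_bigr => v _.
by case: (v \in A); rewrite ?mulr1 ?mulr0.
Qed.

Lemma ind_rowT_laplacian : ind_row setT *m L = 0.
Proof.
apply/matrixP => i j; rewrite ind_row_laplacian !mxE inE /degree.
by rewrite [X in _ - #|pred_of_set X|%:R](_ : _ = [set w | e (enum_val j) w]) ?subrr //;
   apply/setP => w; rewrite !inE.
Qed.

(** The vectors [x] and [z] are the indicators projected off the constants, scaled by [n] to avoid
    division. Cauchy-Schwarz applied to [x *m L - d *: x] and [z], with the deviation bound on the
    former, gives the estimate times [n ^+ 2]. *)
Lemma laplacian_mixing (sigma : #|V|.-tuple R) (theta : R) (A B : {set V}) :
  ordered_eigenvalues L sigma ->
  (forall i : 'I_#|V|, (0 < i)%N ->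
     tnth sigma i != 0 /\ `|d - tnth sigma i| <= theta) ->
  (0 < #|V|)%N ->
  (n * ((\sum_(v in A :&: B) degree e v)%:R - (edges A B)%:R)
    - d * (n * #|A :&: B|%:R - #|A|%:R * #|B|%:R)) ^+ 2
  <= theta ^+ 2 * (#|A|%:R * (n - #|A|%:R)) * (#|B|%:R * (n - #|B|%:R)).
Proof.
move=> [_ L_char] sigma_bound V_gt0; set a : R := #|A|%:R; set b : R := #|B|%:R.
have n_gt0 : 0 < n by rewrite ltr0n.
pose one := ind_row setT.
pose x := n *: ind_row A - a *: one; pose z := n *: ind_row B - b *: one.
have oneE (C : {set V}) : '[one, ind_row C] = #|C|%:R.
  by rewrite ind_rowM setTI.
have Eone (C : {set V}) : '[ind_row C, one] = #|C|%:R.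
  by rewrite ind_rowM setIT.
have oo : '[one, one] = n by rewrite oneE cardsT.
have one0 : one != 0.
  apply: contraTneq n_gt0 => one0; have := oneE setT.
  by rewrite one0 mul0mx mxE cardsT => <-; rewrite ltxx.
have xone : x *m one^T = 0.
  apply/matrixP => i j; rewrite !ord1 row_dotBl [RHS]mxE.
  by rewrite Eone oo mulrC subrr.
pose y := x *m L - d *: x.
have := symmetric_deviation_bound laplacian_sym L_char sigma_bound one0
  ind_rowT_laplacian xone (erefl y).
set q : R := _ - (edges A B)%:R; set r := _ - d * _.
have xx : '[x, x] = n * (a * (n - a)).
  rewrite row_dotBl !row_dotBr oo !Eone !oneE !ind_rowM !setIid -/a; ring.
have zz : '[z, z] = n * (b * (n - b)).
  rewrite row_dotBl !row_dotBr oo !Eone !oneE !ind_rowM !setIid -/b; ring.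
have xz : '[x, z] = n * (n * #|A :&: B|%:R - a * b).
  rewrite row_dotBl !row_dotBr oo !Eone !oneE !ind_rowM -/b -/a; ring.
have Lone (u : 'rV[R]_#|V|) : '[u *m L, one] = 0.
  by rewrite -mulmxA -laplacian_sym -trmx_mul ind_rowT_laplacian trmx0 mulmx0 mxE.
have xLz : '[x *m L, z] = n ^+ 2 * q.
  rewrite row_dotBr Lone mulmxBl -!scalemxAl ind_rowT_laplacian scaler0 subr0.
  by rewrite -[n *: _]subr0 -(scale0r 0) row_dotBl ind_row_laplacian_dot /q; ring.
have yz : '[y, z] = n * r.
  by rewrite /y -[x *m L]scale1r row_dotBl xz xLz /r; ring.
have := row_cauchy_schwarz y z; rewrite yz xx zz => /le_trans yz_le xx_le.
have zz_ge0 : 0 <= n * (b * (n - b)).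
  by rewrite mulr_ge0 ?ler0n // mulr_ge0 ?ler0n // subr_ge0 ler_nat max_card.
have {yz_le}yz_le := yz_le _ (ler_wpM2r zz_ge0 xx_le).
rewrite -(ler_pM2l (exprn_gt0 2 n_gt0)) -exprMn; apply: le_trans yz_le _.
by rewrite le_eqVlt; apply/orP; left; apply/eqP; ring.
Qed.

End Laplacian.

(** * Real arithmetic of the separator estimate *)

Lemma sqr_le_bounds (R : realDomainType) (x y : R) :
  0 <= y -> x ^+ 2 <= y ^+ 2 -> - y <= x <= y.
Proof.
move=> y_ge0; rewrite -ler_norml -[x ^+ 2]real_normK ?num_real //.
by rewrite ler_pXn2r ?nnegrE.
Qed.

(** Here [a] and [s] are the sizes of the smaller part and of the separator, [E] counts the edges
    between them, and [T] is the left side of the main hypothesis. *)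
Lemma separator_arith (R : realFieldType) (n d delta theta a s T E : R) :
  0 <= theta -> 1 <= a -> 0 <= s -> 0 <= n - a -> 0 <= n - s ->
  0 < delta -> delta <= d ->
  (d + theta) * s <= 2 * n * theta -> s <= T ->
  delta * T <= delta ^+ 2 - 25 * theta ^+ 2 ->
  (d + theta) * a <= n * theta -> delta + 1 <= a + s ->
  (d - theta) * (a * (n - a)) <= n * E ->
  (n * E - d * (a * s)) ^+ 2 <= theta ^+ 2 * (a * (n - a)) * (s * (n - s)) ->
  False.
Proof.
move=> t_ge0 a_ge1 s_ge0 na ns delta_gt0 delta_d s_t sT dT a_t as_delta loE mixE.
have a_gt0 : 0 < a by lra.
have d_gt0 : 0 < d by lra.
have n_gt0 : 0 < n by lra.
have dsT : delta * s <= delta * T by rewrite ler_pM2l.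
have ds_ge0 : 0 <= delta * s by rewrite mulr_ge0 // ltW.
have t_delta : 5 * theta <= delta.
  have : (5 * theta) ^+ 2 <= delta ^+ 2 by rewrite exprMn; lra.
  by case/(sqr_le_bounds (ltW delta_gt0))/andP.
have s_delta : s <= delta.
  by rewrite -(ler_pM2l delta_gt0) -expr2; have := sqr_ge0 theta; lra.
(* The bounds on [a], [s] and [E] cost at most [4 * n * theta] out of [n * d], and [5 * theta <= d]
   leaves a fifth; squaring the 5 produces the constant 25. *)
have X_ge : a * n * d <= 5 * (n * E - d * (a * s)).
  have t_d : n * (5 * theta) <= n * d by rewrite ler_pM2l //; lra.
  have ta : 0 <= theta * a by rewrite mulr_ge0 // ltW.
  have ts : 0 <= theta * s by rewrite mulr_ge0.
  have : n * d <= 5 * ((d - theta) * (n - a) - d * s) by lra.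
  by rewrite -(ler_pM2l a_gt0); lra.
have X2 : (a * n * d) ^+ 2 <= 25 * (theta ^+ 2 * (a * n) * (s * n)).
  have and_ge0 : 0 <= a * n * d by rewrite !mulr_ge0 ?ltW.
  have : (a * n * d) ^+ 2 <= (5 * (n * E - d * (a * s))) ^+ 2.
    by rewrite ler_pXn2r ?nnegrE // (le_trans and_ge0).
  have : theta ^+ 2 * (a * (n - a)) * (s * (n - s)) <= theta ^+ 2 * (a * n) * (s * n).
    rewrite ler_pM ?mulr_ge0 ?sqr_ge0 ?(ltW a_gt0) //.
      by rewrite ler_wpM2l ?sqr_ge0 // ler_pM2l //; lra.
    by rewrite ler_wpM2l //; lra.
  by rewrite [(5 * _) ^+ 2]exprMn; lra.
have : a * d ^+ 2 <= 25 * theta ^+ 2 * s.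
  have c_gt0 : 0 < a * n ^+ 2 by rewrite mulr_gt0 ?exprn_gt0.
  by rewrite -(ler_pM2l c_gt0); move: X2; congr (_ <= _); ring.
have : 25 * theta ^+ 2 * s <= 25 * theta ^+ 2 * d.
  by rewrite ler_wpM2l ?mulr_ge0 ?sqr_ge0 //; lra.
(* The 1 in [delta + 1 <= a + s] supplies the extra [delta * d] that makes the final contradiction
   strict. *)
have : (delta + 25 * theta ^+ 2) * d <= a * delta * d.
  have : delta * (delta + 1) <= delta * (a + s) by rewrite ler_pM2l.
  by rewrite ler_pM2r //; lra.
have : a * d * delta <= a * d * d by rewrite ler_pM2l // mulr_gt0.
have : 0 < delta * d by rewrite mulr_gt0.
lra.
Qed.

(** * Independent sets and separators under the mixing inequality *)

Section Mixing.
Variables (R : realType) (V : finType) (e : rel V).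
Hypothesis e_irr : irreflexive e.
Variables n d delta theta : R.
Hypotheses (nE : n = #|V|%:R) (dE : d = avg_degree R e).
Hypothesis deltaE : delta = (min_degree e)%:R.
Hypotheses (theta_ge0 : 0 <= theta) (theta_lt : theta < d).
Hypothesis V_gt0 : (0 < #|V|)%N.
Hypothesis mixing : forall A B : {set V},
  (n * ((\sum_(v in A :&: B) degree e v)%:R - (edges e A B)%:R)
    - d * (n * #|A :&: B|%:R - #|A|%:R * #|B|%:R)) ^+ 2
  <= theta ^+ 2 * (#|A|%:R * (n - #|A|%:R)) * (#|B|%:R * (n - #|B|%:R)).

Lemma edges_eq0 (A B : {set V}) :
  {in A & B, forall x y, ~~ e x y} -> edges e A B = 0%N.
Proof.
move=> eAB; rewrite /edges big1 // => x xA; apply: eq_card0 => y.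
by rewrite inE; case yB: (y \in B) => //=; rewrite (negPf (eAB _ _ xA yB)).
Qed.

Lemma card_compl_ge0 (A : {set V}) : 0 <= n - #|A|%:R.
Proof. by rewrite nE subr_ge0 ler_nat max_card. Qed.

Lemma indep_degree_sum (I : {set V}) :
  {in I &, forall x y, ~~ e x y} ->
  (d - theta) * (#|I|%:R * (n - #|I|%:R)) <= n * (\sum_(v in I) degree e v)%:R
  <= (d + theta) * (#|I|%:R * (n - #|I|%:R)).
Proof.
move=> eI; have := mixing I I; rewrite setIid edges_eq0 // subr0 -mulrA -expr2 -exprMn.
move/sqr_le_bounds; rewrite !mulr_ge0 ?ler0n ?card_compl_ge0 // => /(_ isT) /andP[lo hi].
by apply/andP; split; lra.
Qed.

Lemma degree_bounds (v : V) :
  (d - theta) * (n - 1) <= n * (degree e v)%:R <= (d + theta) * (n - 1).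
Proof.
have := @indep_degree_sum [set v]; rewrite cards1 big_set1 mul1r; apply.
by move=> x y /set1P-> /set1P->; rewrite e_irr.
Qed.

Lemma sum_const_card (c : R) : \sum_(v : V) c = n * c.
Proof. by rewrite nE big_const iter_addr addr0 mulr_natl. Qed.

Lemma sum_degreeE : (\sum_v degree e v)%:R = n * d.
Proof. by rewrite nE dE mulrC divfK ?pnatr_eq0 -?lt0n // natr_sum. Qed.

(** Averaging the upper degree bound over all vertices; together with [theta < d] this rules out
    graphs with at most two vertices. *)
Lemma avg_degree_le : d <= theta * (n - 1).
Proof.
have n_gt0 : 0 < n by rewrite nE ltr0n.
have : n * (n * d) <= n * ((d + theta) * (n - 1)).
  rewrite -sum_degreeE natr_sum mulr_sumr -[leRHS]sum_const_card.
  apply: ler_sum => v _.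
  by case/andP: (degree_bounds v).
by rewrite ler_pM2l // => h; lra.
Qed.

Lemma min_degree_le_avg : delta <= d.
Proof.
have n_gt0 : 0 < n by rewrite nE ltr0n.
rewrite -(ler_pM2l n_gt0) -sum_degreeE natr_sum -[leLHS]sum_const_card.
by apply: ler_sum => v _; rewrite deltaE ler_nat min_degree_le.
Qed.

(** The degree sum over [I] is at least [#|I|] times the lower bound for a single vertex, and at
    most the bound from mixing [I] with itself. *)
Lemma indep_card (I : {set V}) :
  {in I &, forall x y, ~~ e x y} ->
  (d + theta) * #|I|%:R <= 2 * n * theta + d - theta.
Proof.
move=> eI; have n_ge1 : 1 <= n by rewrite nE (ler_nat _ 1).
have [I0|I_gt0] := posnP #|I|.
  have nt : 0 <= n * theta by rewrite mulr_ge0 // nE ler0n.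
  by have d_lt := theta_lt; rewrite I0 mulr0; lra.
have I_gt0' : 0 < (#|I|%:R : R) by rewrite ltr0n.
have /andP[_ up] := indep_degree_sum eI.
have lo : #|I|%:R * ((d - theta) * (n - 1)) <= n * (\sum_(v in I) degree e v)%:R.
  rewrite natr_sum mulr_sumr mulr_natl -sumr_const; apply: ler_sum => v _.
  by case/andP: (degree_bounds v).
have := le_trans lo up; rewrite [(d + theta) * _]mulrCA ler_pM2l // => h; lra.
Qed.

(** The neighbours of a vertex of [A] lie in [A] or in the separator, and the vertex itself is not
    among them. *)
Lemma separator_min_degree (A B : {set V}) :
  A != set0 -> {in A & B, forall x y, ~~ e x y} ->
  (min_degree e < #|A| + #|~: (A :|: B)|)%N.
Proof.
case/set0Pn=> v vA eAB; apply: leq_ltn_trans (min_degree_le e v) _.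
rewrite (cardsD1 v A) vA add1n addSn ltnS; apply: leq_trans (leq_card_setU _ _).
apply: subset_leq_card; apply/subsetP => w; rewrite !inE => vw.
have wv : w != v by apply: contraTneq vw => ->; rewrite e_irr.
rewrite wv /=; case wA: (w \in A) => //=.
by apply: contraL vw => wB; apply: eAB.
Qed.

(** With no edges between the parts, mixing bounds [d ^+ 2 * a * b] by
    [theta ^+ 2 * (n - a) * (n - b)]. If the claim failed, [d * a] would exceed [theta * (n - a)],
    likewise for the larger [b], and the product would contradict this. *)
Lemma separated_small_part (A B : {set V}) :
  A != set0 -> [disjoint A & B] -> {in A & B, forall x y, ~~ e x y} ->
  (#|A| <= #|B|)%N -> (d + theta) * #|A|%:R <= n * theta.
Proof.
move=> A0 AB eAB AB_card; have := mixing A B.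
have /eqP AB0 : A :&: B == set0 by rewrite setI_eq0.
have [t_ge0 d_lt] := (theta_ge0, theta_lt).
rewrite AB0 big_set0 cards0 edges_eq0 // subrr mulr0 !sub0r mulrN opprK.
have: (0 < #|A|)%N by rewrite card_gt0.
have : (#|A| + #|B| <= #|V|)%N by rewrite -cardsUI AB0 cards0 addn0 max_card.
rewrite -(ler_nat R) natrD -nE -(ltr_nat R); move: AB_card; rewrite -(ler_nat R).
set a : R := #|A|%:R; set b : R := #|B|%:R => ab abn a_gt0 mixAB.
rewrite leNgt; apply/negP => h.
have ha : theta * (n - a) < d * a by lra.
have a0 : 0 <= theta * (n - a) by rewrite mulr_ge0 ?card_compl_ge0.
have b0 : 0 <= theta * (n - b) by rewrite mulr_ge0 ?card_compl_ge0.
have d_gt0 : 0 < d by apply: le_lt_trans theta_lt.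
have hb : theta * (n - b) <= d * b.
  have := ler_wpM2l t_ge0 ab; have := ler_wpM2l (ltW d_gt0) ab; lra.
have b_gt0 : 0 < b by apply: lt_le_trans ab.
have : theta * (n - a) * (theta * (n - b)) < d * a * (d * b).
  apply: le_lt_trans (ler_wpM2l a0 hb) _.
  by rewrite ltr_pM2r // mulr_gt0.
have ab_gt0 : 0 < a * b by rewrite mulr_gt0.
rewrite -(ltr_pM2l ab_gt0) ltNge => /negP[].
by move: mixAB; congr (_ <= _); ring.
Qed.

Lemma separator_contra (A B : {set V}) (T : R) :
  A != set0 -> [disjoint A & B] -> {in A & B, forall x y, ~~ e x y} ->
  (#|A| <= #|B|)%N ->
  (d + theta) * #|~: (A :|: B)|%:R <= 2 * n * theta ->
  #|~: (A :|: B)|%:R <= T -> delta * T <= delta ^+ 2 - 25 * theta ^+ 2 ->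
  0 < delta -> False.
Proof.

move=> A0 AB eAB AB_card s_card sT dT delta_gt0.
have aux := separated_small_part A0 AB eAB AB_card.
have A_gt0 : (0 < #|A|)%N by rewrite card_gt0.
have := separator_min_degree A0 eAB; rewrite -(ler_nat R) -natr1 natrD -deltaE.
have := mixing A (~: A); rewrite setICr big_set0 cards0 mulr0 !sub0r.
have -> : #|~: A|%:R = n - #|A|%:R :> R.
  by rewrite cardsCs setCK natrB ?max_card -?nE.
have := mixing A (~: (A :|: B)).
(* All edges leaving [A] end in the separator, so both mixing inequalities concern the same
   count. *)
have -> : edges e A (~: (A :|: B)) = edges e A (~: A).
  apply: eq_bigr => x xA; apply: eq_card => y; rewrite !inE.
  case yA: (y \in A) => //=; case yB: (y \in B) => //=.
  by rewrite (negPf (eAB _ _ xA yB)).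
have -> : A :&: ~: (A :|: B) = set0.
  by rewrite setCU setIA setICr set0I.
rewrite big_set0 cards0 mulr0 !sub0r.
have n_ge := card_compl_ge0 (~: (A :|: B)); have na_ge := card_compl_ge0 A.
have delta_le := min_degree_le_avg.
move: A_gt0 s_card sT aux n_ge na_ge; rewrite -(ler_nat R).
set a : R := #|A|%:R; set s : R := #|_|%:R; set E : R := (edges _ _ _)%:R.
have s_ge0 : 0 <= s by apply: ler0n.
move=> a_ge1 s_card sT aux n_ge na_ge mixS mixC deg.
have nE_ge : (d - theta) * (a * (n - a)) <= n * E.
  have an_ge0 : 0 <= theta * (a * (n - a)) by rewrite !mulr_ge0 ?ler0n.
  have : (n * (- E) - d * (- (a * (n - a)))) ^+ 2 <= (theta * (a * (n - a))) ^+ 2.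
    by apply: le_trans mixC _; rewrite le_eqVlt; apply/orP; left; apply/eqP; ring.
  by case/(sqr_le_bounds an_ge0)/andP=> lo hi; lra.
apply: (separator_arith theta_ge0 a_ge1 s_ge0 na_ge n_ge delta_gt0 delta_le
  s_card sT dT aux deg nE_ge).
by move: mixS; congr (_ <= _); ring.
Qed.

End Mixing.

(** * Hamiltonicity from the eigenvalue condition *)

Theorem theorem3p3 (R : realType) (V : finType) (e : rel V)
  (e_sym : symmetric e) (e_irr : irreflexive e)
  (delta_ge1 : (1 <= min_degree e)%N)
  (sigma : #|V|.-tuple R)
  (sigmaP : ordered_eigenvalues (laplacian_mx R e) sigma)
  (theta : R) (theta_ge0 : 0 <= theta)
  (theta_bound : forall i : 'I_#|V|, (1 <= i)%N ->
     `|avg_degree R e - tnth sigma i| <= theta)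
  (hineq :
     (2 * #|V|%:R * theta + avg_degree R e) / (avg_degree R e + theta)
     <= (min_degree e)%:R
        - (2 + 2 * Num.sqrt 3) ^+ 2 * (theta ^+ 2 / (min_degree e)%:R)) :
  hamiltonian e.
Proof.
set n : R := #|V|%:R; set delta : R := (min_degree e)%:R.
rewrite -/n -/delta in hineq; set c : R := (2 + 2 * Num.sqrt 3) ^+ 2 in hineq *.
set d := avg_degree R e in theta_bound hineq *.
(* On the empty vertex type [min_degree] takes its default value 0, contradicting [delta_ge1]. *)
have [v0 _|V0] := pickP V; last first.
  by move: delta_ge1; rewrite /min_degree big_pred0 // eq_card0.
have V_gt0 : (0 < #|V|)%N by apply/card_gt0P; exists v0.
have delta_lt : delta < n.
  rewrite ltr_nat; apply: leq_ltn_trans (min_degree_le e v0) _.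
  rewrite -cardsT; apply: proper_card; apply/properP; split; first exact: subsetT.
  by exists v0; rewrite !inE ?e_irr.
have delta_gt0 : 0 < delta by rewrite ltr0n.
have delta_le : delta <= d := min_degree_le_avg erefl erefl erefl V_gt0.
have d_gt0 : 0 < d := lt_le_trans delta_gt0 delta_le.
have dt_gt0 : 0 < d + theta by rewrite ltr_wpDr.
have c_ge : 25 <= c.
  have sqrt3_ge : 3 / 2 <= Num.sqrt 3 :> R.
    have := sqr_sqrtr (ler0n R 3); have := sqrtr_ge0 (3 : R); nra.
  have : 5 ^+ 2 <= c by rewrite ler_pXn2r ?nnegrE //; lra.
  by lra.
set T := delta - _ in hineq.
have dT : delta * T <= delta ^+ 2 - 25 * theta ^+ 2.
  have -> : delta * T = delta ^+ 2 - c * theta ^+ 2.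
    by rewrite /T; field; rewrite gt_eqF.
  by have := ler_wpM2r (sqr_ge0 theta) c_ge; lra.
have T_le : T <= delta.
  by rewrite /T gerBl mulr_ge0 ?divr_ge0 ?sqr_ge0 ?ltW // (lt_le_trans _ c_ge).
have nT : 2 * n * theta + d <= T * (d + theta) by rewrite -ler_pdivrMr.
(* If [d <= theta], then [T <= delta < n] would give [2 * n * theta + d <= n * (d + theta) <= 2 * n
   * theta]. *)
have theta_lt : theta < d.
  rewrite ltNge; apply/negP => dt.
  have : T * (d + theta) <= n * (d + theta).
    by rewrite ler_pM2r // (le_trans T_le) // ltW.
  have : n * (d + theta) <= n * (2 * theta) by rewrite ler_wpM2l ?ler0n //; lra.
  by lra.
have sigma_bound (i : 'I_#|V|) :
    (0 < i)%N -> tnth sigma i != 0 /\ `|d - tnth sigma i| <= theta.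
  move=> i_gt0; split; last exact: theta_bound.
  (* A second zero eigenvalue would be at distance [d > theta] from [d]. *)
  apply/eqP => si; have := theta_bound i i_gt0.
  by rewrite si subr0 gtr0_norm // leNgt theta_lt.
have mixing := laplacian_mixing e_sym _ _ sigmaP sigma_bound V_gt0.
apply: chvatal_erdos => //.
- have := avg_degree_le e_irr erefl erefl theta_ge0 V_gt0 mixing.
  rewrite -/n -/d => d_le; rewrite ltnNge -(ler_nat R) -/n; apply/negP => n2.
  have : theta * (n - 1) <= theta * 1 by rewrite ler_wpM2l //; lra.
  by lra.
- have /card_gt0P[w] := leq_trans delta_ge1 (min_degree_le e v0).
  by rewrite inE => v0w; exists v0, w.
move=> A B I A0 B0 AB eAB eI; rewrite leqNgt; apply/negP => sI.
have I_card := indep_card e_irr erefl theta_ge0 theta_lt V_gt0 mixing eI.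
rewrite -/n -/d in I_card.
(* The strict inequality [sI] gains one vertex, which absorbs the term [d] in the bound on [I]. *)
have s_card : (d + theta) * #|~: (A :|: B)|%:R <= 2 * n * theta.
  have : (d + theta) * (#|~: (A :|: B)|%:R + 1) <= (d + theta) * #|I|%:R.
    by rewrite ler_pM2l // natr1 ler_nat.
  by lra.
have sT : #|~: (A :|: B)|%:R <= T.
  by rewrite -(ler_pM2l dt_gt0); lra.
have contra := separator_contra e_irr erefl erefl erefl theta_ge0 theta_lt V_gt0 mixing.
(* The two parts play symmetric roles, so the smaller one is taken first. *)
have [AB_card|/ltnW BA_card] := leqP #|A| #|B|.
  exact: (contra A B T).
rewrite setUC in s_card sT; apply: (contra B A T) => //.
  by rewrite disjoint_sym.
by move=> x y xB yA; rewrite e_sym eAB.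
Qed.
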